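(* Let $B$ be a Banach space, $D$ a nonempty closed convex subset of $B$, and $T:D\to D$ a contraction, i.e. there is $\delta\in(0,1)$ such that $\|Tx-Ty\|\le\delta\|x-y\|$ for all $x,y\in D$; let $x_*$ be the (unique) fixed point of $T$. Let $\{\eta_n^0\}_{n=0}^\infty$, $\{\eta_n^1\}_{n=0}^\infty$, $\{\eta_n^2\}_{n=0}^\infty$ be real sequences in $[0,1]$ satisfying $\sum_{k=0}^{\infty}\eta_k^1\eta_k^2=\infty$. Let $u_0\in D$ and let $\{u_n\}_{n=0}^\infty$ be defined by the CR iteration $$u_{n+1}=(1-\eta_n^0)v_n+\eta_n^0Tv_n,\qquad v_n=(1-\eta_n^1)Tu_n+\eta_n^1Tw_n,\qquad w_n=(1-\eta_n^2)u_n+\eta_n^2Tu_n,\qquad n\in\mathbb{N}.$$ Let $x_0\in D$ and let $\{x_n\}_{n=0}^\infty$ be defined by the Picard-S iteration $$x_{n+1}=Ty_n,\qquad y_n=(1-\eta_n^1)Tx_n+\eta_n^1Tz_n,\qquad z_n=(1-\eta_n^2)x_n+\eta_n^2Tx_n,\qquad n\in\mathbb{N}.$$ Then the following are equivalent: (i) $\lim_{n\to\infty}\|x_n-x_*\|=0$; (ii) $\lim_{n\to\infty}\|u_n-x_*\|=0$.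
   Context: $\mathbb{N}$ denotes the set of nonnegative integers $\{0,1,2,\dots\}$. The superscripts in $\eta_n^0,\eta_n^1,\eta_n^2$ are indices, not powers. *)

(* Defs.v *)
From mathcomp Require Export all_boot all_order all_algebra.
From mathcomp Require Export all_classical all_reals all_analysis.
Export Order.TTheory GRing.Theory Num.Theory.
Export numFieldNormedType.Exports.

(* Main.v *)
(** Both limits hold unconditionally. If a point of [D] lies within [r] of the
    fixed point, then so do its convex combinations with its image under [T],
    and applying [T] shrinks [r] to [delta * r]; hence one step of either
    iteration multiplies the distance to the fixed point by at most [delta],
    and both sequences converge geometrically. *)
Require Import Defs.
Set Implicit Arguments.
Unset Strict Implicit.
Unset Printing Implicit Defensive.
Local Open Scope classical_set_scope.
Local Open Scope ring_scope.


Lemma convex_set_comb (R : realType) (M : lmodType R) (A : set M) (t : R)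
    (a b : M) :
  convex_set (A : set (convex_lmodType M)) -> 0 <= t <= 1 -> A a -> A b ->
  A ((1 - t) *: a + t *: b).
Proof.
move=> Acvx /andP[t0 t1] Aa Ab.
have := Acvx b a (Itv01 t0 t1); rewrite !inE => /(_ Ab Aa).
by rewrite /conv /= addrC.
Qed.

(** Closed balls are convex: the weights sum to 1, so [p] is the same combination of itself and the
    difference splits termwise. *)
Lemma ler_norm_comb (R : realType) (V : normedModType R) (p a b : V) (t r : R) :
  0 <= t <= 1 -> `|a - p| <= r -> `|b - p| <= r ->
  `|(1 - t) *: a + t *: b - p| <= r.
Proof.
move=> /andP[t0 t1] ar br; have t1' : 0 <= 1 - t by rewrite subr_ge0.
have -> : (1 - t) *: a + t *: b - p = (1 - t) *: (a - p) + t *: (b - p).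
  by rewrite !scalerBr addrACA -opprD -scalerDl subrK scale1r.
apply: le_trans (ler_normD _ _) _; rewrite !normrZ !ger0_norm//.
rewrite [leRHS](_ : r = (1 - t) * r + t * r); first by rewrite lerD ?ler_wpM2l.
by rewrite -mulrDl subrK mul1r.
Qed.

Lemma cvg_norm_geometric (R : realType) (V : normedModType R) (a : nat -> V)
    (p : V) (c d : R) : 0 <= d < 1 ->
  (forall n, `|a n - p| <= d ^+ n * c) -> `|a n - p| @[n --> \oo] --> 0.
Proof.
move=> /andP[d0 d1] ac.
apply: (squeeze_cvgr (f := cst 0) (h := geometric c d)).
- by near=> n; rewrite normr_ge0 /= mulrC ac.
- exact: cvg_cst.
- by apply: cvg_geometric; rewrite ger0_norm.
Unshelve. all: by end_near. Qed.

Theorem theorem2 (R : realType) (B : completeNormedModType R)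
  (D : set B) (D_nonempty : D !=set0) (D_closed : closed D)
  (D_convex : convex_set D)
  (T : {fun D >-> D})
  (delta : {nonneg R}) (delta_gt0 : 0 < delta%:num)
  (T_contraction : contraction delta T)
  (xstar : B) (xstar_in : D xstar) (xstar_fixed : T xstar = xstar)
  (eta0 eta1 eta2 : nat -> R)
  (eta0_01 : forall n, 0 <= eta0 n <= 1)
  (eta1_01 : forall n, 0 <= eta1 n <= 1)
  (eta2_01 : forall n, 0 <= eta2 n <= 1)
  (eta12_diverges :
    (\sum_(0 <= k < n) eta1 k * eta2 k) @[n --> \oo] --> +oo)
  (u v w : nat -> B) (u0_in : D (u 0%N))
  (CR_u : forall n, u n.+1 = (1 - eta0 n) *: v n + eta0 n *: T (v n))
  (CR_v : forall n, v n = (1 - eta1 n) *: T (u n) + eta1 n *: T (w n))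
  (CR_w : forall n, w n = (1 - eta2 n) *: u n + eta2 n *: T (u n))
  (x y z : nat -> B) (x0_in : D (x 0%N))
  (PS_x : forall n, x n.+1 = T (y n))
  (PS_y : forall n, y n = (1 - eta1 n) *: T (x n) + eta1 n *: T (z n))
  (PS_z : forall n, z n = (1 - eta2 n) *: x n + eta2 n *: T (x n)) :
  `|x n - xstar| @[n --> \oo] --> 0 <-> `|u n - xstar| @[n --> \oo] --> 0.
Proof.
case: T_contraction => delta1 T_lip.
(* Membership in [D] travels with the bound, since [T] contracts only on [D]. *)
pose K (r : R) : set B := [set a | D a /\ `|a - xstar| <= r].
have d01 : 0 <= delta%:num < 1 by rewrite ltW.
have KT r a : K r a -> K (delta%:num * r) (T a).
  move=> [Da ar]; split; first exact: funS.
  rewrite -{1}xstar_fixed; apply: le_trans (ler_wpM2l (ltW delta_gt0) ar).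
  exact: (T_lip (a, xstar)).
have KTW r a : 0 <= r -> K r a -> K r (T a).
  move=> r0 /KT[DTa Ta]; split=> //; apply: le_trans Ta _.
  by rewrite ler_piMl// ltW.
have Kcomb r t a b : 0 <= t <= 1 -> K r a -> K r b ->
    K r ((1 - t) *: a + t *: b).
  move=> t01 [Da ar] [Db br]; split; first exact: convex_set_comb.
  exact: ler_norm_comb.
(* An inhabited [K r] supplies the sign of [r] that [KTW] asks for. *)
have K_norm r a : K r a -> 0 <= r by move=> [_]; apply: le_trans.
(* This is the pattern common to [v] and [y]. The inner combination merely stays in [K r]; the
   factor [delta] comes from the [T] applied to both terms of the outer one. *)
have Kinner n r a : K r a -> K (delta%:num * r) ((1 - eta1 n) *: T a
    + eta1 n *: T ((1 - eta2 n) *: a + eta2 n *: T a)).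
  move=> Ka; apply: (Kcomb) => //; apply: KT => //; apply: Kcomb => //.
  by apply: KTW => //; apply: K_norm Ka.
(* The one-step hypothesis covers every [r], so the induction can take the current bound
   [delta ^+ n] times the initial distance. *)
have decay (a : nat -> B) : D (a 0) ->
    (forall n r, K r (a n) -> K (delta%:num * r) (a n.+1)) ->
    `|a n - xstar| @[n --> \oo] --> 0.
  move=> Da0 aS; apply: (cvg_norm_geometric (c := `|a 0 - xstar|) d01) => n.
  suff [] : K (delta%:num ^+ n * `|a 0 - xstar|) (a n) by [].
  elim: n => [|n IHn]; first by rewrite expr0 mul1r.
  by rewrite exprS -mulrA; apply: aS.
split=> _; apply: decay => // n r Kr.
(* [v n] has already gained [delta]; mixing it with its image must only not lose it. *)
- have Kv : K (delta%:num * r) (v n) by rewrite CR_v CR_w; apply: Kinner.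
  by rewrite CR_u; apply: Kcomb => //; apply: KTW => //; apply: K_norm Kv.
(* The last [T] would give a second factor [delta]; one is enough, so the weaker [KTW] keeps the
   radius. *)
- have Ky : K (delta%:num * r) (y n) by rewrite PS_y PS_z; apply: Kinner.
  by rewrite PS_x; apply: KTW => //; apply: K_norm Ky.
Qed.
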